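(* For every integer $n\ge 0$, \[ \overline{p}_o(2n)=\overline{p}(n)+2\sum_{k=1}^{\infty}\overline{p}(n-2k^2). \]
   Context: An overpartition of $n$ is a partition of $n$ in which the first occurrence of each part size may be overlined. $\overline{p}(n)$ is the number of overpartitions of $n$, with $\sum_{n\ge0}\overline{p}(n)q^n=\frac{(-q;q)_\infty}{(q;q)_\infty}$; $\overline{p}_o(n)$ is the number of overpartitions of $n$ into odd parts, with $\sum_{n\ge0}\overline{p}_o(n)q^n=\frac{(-q;q^2)_\infty}{(q;q^2)_\infty}$, where $(a;q)_\infty=\prod_{k\ge1}(1-aq^{k-1})$. Convention: $\overline{p}(x)=0$ whenever $x$ is not a nonnegative integer. *)

(* Defs.v *)
From HB Require Import structures.
From mathcomp Require Import all_boot all_order all_algebra.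
From mathcomp Require Import classical_sets cardinality fsbigop.

Set Implicit Arguments.
Unset Strict Implicit.
Unset Printing Implicit Defensive.

(* An overpartition is written as the list of its parts, in nonincreasing
   order, each carrying a boolean that is true when the part is overlined. *)
Definition parts (s : seq (nat * bool)) : seq nat := unzip1 s.

Definition overlined (s : seq (nat * bool)) (i : nat) : bool :=
  nth false (unzip2 s) i.

(* [index x t] is the position of the first occurrence of [x] in [t]. *)
Definition first_occurrence (s : seq (nat * bool)) (i : nat) : bool :=
  index (nth 0 (parts s) i) (parts s) == i.

Definition is_partition (n : nat) (t : seq nat) : bool :=
  [&& sorted geq t, all (leq 1) t & sumn t == n].

Definition is_overpartition (n : nat) (s : seq (nat * bool)) : bool :=
  is_partition n (parts s)
  && all (fun i => overlined s i ==> first_occurrence s i) (iota 0 (size s)).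

Definition odd_parts (s : seq (nat * bool)) : bool := all odd (parts s).

Definition forget_bound (n : nat) (s : n.-bseq ('I_n.+1 * bool)) :
  seq (nat * bool) := [seq (nat_of_ord x.1, x.2) | x <- s].

(* The number of overpartitions of n satisfying P. A partition of n has at
   most n parts, each at most n, so counting lists within these bounds loses
   nothing: see [num_overpartitionsE]. *)
Definition num_overpartitions (P : pred (seq (nat * bool))) (n : nat) : nat :=
  #|[pred s : n.-bseq ('I_n.+1 * bool) |
      is_overpartition n (forget_bound s) && P (forget_bound s)]|.

Definition pbar (x : int) : nat :=
  if x is Posz n then num_overpartitions predT n else 0.

Definition pbar_odd (n : nat) : nat := num_overpartitions odd_parts n.

Lemma forget_bound_inj (n : nat) : injective (@forget_bound n).
Proof.
move=> s1 s2 /inj_map H; apply/val_inj/H => -[a b] [c d] /= [ac ->].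
by rewrite (val_inj ac).
Qed.

Lemma overpartition_bounded (n : nat) (s : seq (nat * bool)) :
  is_overpartition n s -> exists t : n.-bseq ('I_n.+1 * bool), forget_bound t = s.
Proof.
case/andP => /and3P[_ pos_s /eqP sum_s] _.
have szs : size s <= n.
  rewrite -sum_s; elim: s pos_s {sum_s} => //= x s IH /andP[x0 /IH].
  by rewrite /= -add1n; apply: leq_add.
have les : all (fun x => x.1 < n.+1) s.
  rewrite -sum_s; elim: s {pos_s sum_s szs} => //= x s IH.
  rewrite ltnS leq_addr /=; apply: sub_all IH => y.
  by rewrite !ltnS => /leq_trans; apply; exact: leq_addl.
have szt : size [seq (inord x.1 : 'I_n.+1, x.2) | x <- s] <= n.
  by rewrite size_map.
exists (Bseq szt); rewrite /forget_bound /= -map_comp.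
rewrite -[RHS]map_id; apply/eq_in_map => -[a b] /(allP les) /= an.
by rewrite inordK.
Qed.

Lemma num_overpartitionsE (P : pred (seq (nat * bool))) (n : nat)
    (e : seq (seq (nat * bool))) :
  uniq e -> (forall s, (s \in e) = is_overpartition n s && P s) ->
  num_overpartitions P n = size e.
Proof.
move=> ue memE; rewrite /num_overpartitions cardE.
rewrite -(size_map (@forget_bound n)); apply/perm_size/uniq_perm => //.
  by rewrite map_inj_uniq ?enum_uniq //; exact: forget_bound_inj.
move=> s; rewrite memE; apply/mapP/idP => [[t]|Hs].
  by rewrite mem_enum inE => Ht ->.
have /andP[/overpartition_bounded[t ts] _] := Hs.
by exists t; rewrite // mem_enum inE ts.
Qed.

(* A finitely supported big operator is the neutral element by convention when
   the support is infinite; this never happens in the sum of interest. *)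
Lemma pbar_support_finite (n : nat) :
  finite_set [set k | 1 <= k /\ pbar (n%:Z - 2 * k%:Z ^+ 2)%R <> 0]%classic.
Proof.
apply: (@sub_finite_set _ _ `I_n.+1); last exact: finite_II.
move=> k /= [k1 Hk]; rewrite ltnS leqNgt; apply/negP => nk; apply: Hk.
have /Order.POrderTheory.lt_geF : (n%:Z - 2 * k%:Z ^+ 2 < 0 :> int)%R.
  rewrite GRing.exprS GRing.expr1 Num.Theory.subr_lt0 -!PoszM ltz_nat.
  apply: leq_trans nk _.
  by rewrite mulnA leq_pmull // muln_gt0.
by case: (n%:Z - 2 * k%:Z ^+ 2)%R.
Qed.

(* Main.v *)
Require Import Defs.
From HB Require Import structures.
From mathcomp Require Import all_boot all_order all_algebra.
From mathcomp Require Import classical_sets cardinality fsbigop.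
From mathcomp Require Import zify ring.

(** Writing phi(q) for the sum of q^(j^2) over all integers j, the special case
    phi(q) = (-q; q^2)^2 (q^2; q^2) of the Jacobi triple product and Euler's
    identity 1 / (q^2; q^4) = (-q^2; q^2) give
      (-q; q^2) / (q; q^2) = (-q; q^2)^2 / (q^2; q^4)
                           = phi(q) (-q^2; q^2) / (q^2; q^2),
    and the theorem compares the coefficients of q^(2n): only even j = 2k
    contribute. Power series are replaced by integer polynomials modulo a power
    of 'X; the triple product comes from its finite form
      prod_(i < n) (1 + q^(2i+1))^2 = sum_j q^(j^2) [2n choose n+j]_(q^2),
    a specialization of the q-binomial theorem. The generating functions are
    obtained by stripping the first part of an overpartition: with A_N counting
    the overpartitions into parts at most N and B_N those among them with no
    overlined N, A_N = (1 + q^N) B_N and B_N = A_(N-1) + q^N B_N. *)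

Import GRing.Theory.

(** * Overpartitions as lists that can be stripped of their first part *)

Definition overpart_rel (x y : nat * bool) : bool :=
  (y.1 <= x.1) && (y.2 ==> (y.1 != x.1)).

(** An entry is a first occurrence when it differs from all earlier ones, so the condition on
    positions is a pairwise one, which passes to tails. *)
Lemma is_overpartitionE n s :
  is_overpartition n s =
  [&& pairwise overpart_rel s, all (leq 1) (parts s) & sumn (parts s) == n].
Proof.
rewrite /is_overpartition /is_partition sorted_pairwise; last first.
  by move=> a b c /= ba ac; exact: leq_trans ac ba.
suff <- : pairwise geq (parts s) &&
    all (fun i => overlined s i ==> first_occurrence s i) (iota 0 (size s)) =
    pairwise overpart_rel s.
  by case: pairwise => //=; rewrite andbC.
elim: s => //= x s IH.
rewrite -[1%N]/(1 + 0)%N iotaDl all_map -IH /parts /= all_map.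
rewrite {1}/first_occurrence /= eqxx implybT /=.
(* The entry at position [i + 1] is a first occurrence iff it differs from the head and is a first
   occurrence within the tail. *)
have -> : all (preim (addn 1) (fun i =>
      overlined (x :: s) i ==> first_occurrence (x :: s) i)) (iota 0 (size s)) =
    all (fun y => y.2 ==> (y.1 != x.1)) s &&
    all (fun i => overlined s i ==> first_occurrence s i) (iota 0 (size s)).
  have -> : all (fun y => y.2 ==> (y.1 != x.1)) s =
      all (fun i => overlined s i ==> (nth 0%N (parts s) i != x.1))
        (iota 0 (size s)).
    have {1}-> : s = [seq (nth 0%N (parts s) i, overlined s i) | i <- iota 0 (size s)].
      apply: (@eq_from_nth _ (0%N, false)); first by rewrite size_map size_iota.
      move=> i lt_i; rewrite (nth_map 0%N) ?size_iota // nth_iota // add0n.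
      by rewrite /overlined /parts !(nth_map (0%N, false)) //; case: nth.
    by rewrite all_map.
  rewrite -all_predI; apply: eq_all => i /=.
  rewrite /overlined /first_occurrence /= add0n add1n.
  case: (nth false _ _) => //=; rewrite [in RHS]eq_sym.
  by case: (x.1 == _).
have -> : all (overpart_rel x) s =
  all (preim fst (geq x.1)) s && all (fun y => y.2 ==> (y.1 != x.1)) s.
  by rewrite -all_predI.
by rewrite -!andbA; bool_congr; rewrite andbCA.
Qed.

Lemma is_overpartition_cons n x s :
  is_overpartition n (x :: s) =
  [&& 0 < x.1, x.1 <= n, all (overpart_rel x) s & is_overpartition (n - x.1) s]%N.
Proof.
rewrite !is_overpartitionE /=.
have -> : (x.1 + sumn (unzip1 s) == n)%N =
    (x.1 <= n)%N && (sumn (parts s) == n - x.1)%N.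
  rewrite /parts; lia.
by rewrite /parts -!andbA; do !bool_congr; rewrite andbCA; do !bool_congr.
Qed.

Lemma overpartition_enum (P : pred (seq (nat * bool))) n :
  exists2 e, uniq e & forall s, (s \in e) = is_overpartition n s && P s.
Proof.
exists [seq forget_bound t | t : n.-bseq ('I_n.+1 * bool) in
   [pred t | is_overpartition n (forget_bound t) && P (forget_bound t)]].
  by rewrite map_inj_uniq ?enum_uniq //; exact: forget_bound_inj.
move=> s; apply/mapP/idP => [[t]|Hs]; first by rewrite mem_enum inE => Ht ->.
have /andP[/overpartition_bounded[t ts] _] := Hs.
by exists t; rewrite // mem_enum inE ts.
Qed.

Lemma eq_num_overpartitions (P Q : pred (seq (nat * bool))) n :
  (forall s, is_overpartition n s -> P s = Q s) ->
  num_overpartitions P n = num_overpartitions Q n.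
Proof.
move=> PQ; have [e ue eP] := overpartition_enum P n.
rewrite (num_overpartitionsE ue eP); apply/esym/num_overpartitionsE => // s.
by rewrite eP; case: (boolP (is_overpartition n s)) => //= /PQ.
Qed.

(** The overpartitions in [P] but not in [Q] all start with [x], and deleting this head maps them
    bijectively onto the overpartitions of [n - x.1] in [Q']. *)
Lemma num_overpartitions_cons (P Q Q' : pred (seq (nat * bool))) x n :
  P [::] = Q [::] ->
  (forall y s, is_overpartition n (y :: s) ->
     P (y :: s) = Q (y :: s) || ((y == x) && Q' s)) ->
  (forall s, is_overpartition n (x :: s) -> Q' s -> ~~ Q (x :: s)) ->
  (forall s, Q' s -> all (overpart_rel x) s) -> (0 < x.1)%N ->
  num_overpartitions P n = (num_overpartitions Q n +
    if x.1 <= n then num_overpartitions Q' (n - x.1) else 0)%N.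
Proof.
move=> P0 PQ QQ' relQ' x0.
have [e ue eQ] := overpartition_enum Q n.
have [e' ue' eQ'] := overpartition_enum Q' (n - x.1).
rewrite (num_overpartitionsE ue eQ) (num_overpartitionsE ue' eQ').
pose e1 := if (x.1 <= n)%N then [seq x :: s | s <- e'] else [::].
have -> : (if x.1 <= n then size e' else 0)%N = size e1.
  by rewrite /e1; case: ifP; rewrite ?size_map.
have mem_e1 y s : (y :: s \in e1) =
    [&& is_overpartition n (y :: s), y == x & Q' s].
  rewrite /e1 is_overpartition_cons; case: ifP => le_xn; last first.
    by case: eqVneq => [->|_]; rewrite ?le_xn ?andbF.
  apply/mapP/idP => [[t]|]; rewrite ?eQ'.
    by case/andP=> ov Qt [-> ->]; rewrite x0 le_xn relQ' // ov eqxx Qt.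
  by case/and3P=> /and4P[_ _ _ ov] /eqP yx Qs; exists s; rewrite ?eQ' -?yx ?ov.
have nil_e1 : ([::] \in e1) = false.
  by rewrite /e1; case: ifP => // _; apply/mapP => -[].
rewrite -size_cat; apply: num_overpartitionsE.
  rewrite cat_uniq ue /=; apply/andP; split; last first.
    by rewrite /e1; case: ifP => // _; rewrite map_inj_uniq // => s t [].
  apply/hasPn => -[|y s]; rewrite ?nil_e1 //.
  rewrite mem_e1 /= => /and3P[ov /eqP yx Qs]; rewrite eQ ov /=.
  by rewrite yx QQ' // -yx.
case=> [|y s]; rewrite mem_cat eQ; first by rewrite nil_e1 orbF P0.
rewrite mem_e1; case: (boolP (is_overpartition n _)) => //= ov.
by rewrite PQ.
Qed.

(** * Recursion on the largest allowed part *)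

Section PartsIn.
Variable D : pred nat.

Definition parts_in N (s : seq (nat * bool)) : bool :=
  all (fun y => (y.1 <= N)%N && D y.1) s.

Definition parts_in_plain N (s : seq (nat * bool)) : bool :=
  parts_in N s && ((N, true) \notin s).

(** The right side says what may follow a part [N]. Whether that [N] is overlined does not matter,
    since no later [N] can be overlined in either case. *)
Lemma parts_in_plain_rel N b s :
  parts_in_plain N s = all (overpart_rel (N, b)) s && all (D \o fst) s.
Proof.
rewrite /parts_in_plain /parts_in.
have -> : (N, true) \notin s = all (fun y => y != (N, true)) s.
  by rewrite -has_pred1 -all_predC.
rewrite -!all_predI; apply: eq_all => -[a c] /=.
rewrite /overpart_rel xpair_eqE /=.
by case: c; case: (a == N); rewrite ?(andbT, andbF).
Qed.

(** This is A_N = (1 + q^N) B_N: an overlined largest part can only be the head, and what follows it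
    has no overlined copy. *)
Lemma num_parts_in_overlined N n : D N.+1 ->
  num_overpartitions (parts_in N.+1) n =
  (num_overpartitions (parts_in_plain N.+1) n +
   if N.+1 <= n then num_overpartitions (parts_in_plain N.+1) (n - N.+1)
   else 0)%N.
Proof.
move=> DN; apply: (@num_overpartitions_cons _ _ _ (N.+1, true)) => //.
- move=> y s; rewrite is_overpartition_cons => /and4P[_ _ rel _].
  rewrite /parts_in_plain in_cons eq_sym.
  case: eqVneq => [yx|yx] /=; last first.
    rewrite orbF; case: (leqP y.1 N.+1) => //= le_y.
    case: (D y.1) => //; case: parts_in => //=.
    (* An overlined [N.+1] in the tail would force [y.1 > N.+1]. *)
    apply/esym/negP => /(allP rel); rewrite /overpart_rel /=.
    case: y yx le_y {rel} => a b; rewrite xpair_eqE /=.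
    by case: ltngtP => //=; lia.
  rewrite andbF /= yx leqnn DN /= -/(parts_in _ _) -/(parts_in_plain _ _).
  rewrite (parts_in_plain_rel _ true) -yx rel /= /parts_in.
  apply: eq_in_all => z /(allP rel); rewrite yx /overpart_rel /=.
  by case/andP=> ->.
- by move=> s _ _; rewrite /parts_in_plain in_cons eqxx andbF.
- by move=> s; rewrite (parts_in_plain_rel _ true) => /andP[].
Qed.

(** This is B_N = A_(N-1) + q^N B_N: either the largest part is absent, or a plain copy of it is the
    head. *)
Lemma num_parts_in_plain N n : D N.+1 ->
  num_overpartitions (parts_in_plain N.+1) n =
  (num_overpartitions (parts_in N) n +
   if N.+1 <= n then num_overpartitions (parts_in_plain N.+1) (n - N.+1)
   else 0)%N.
Proof.
move=> DN; apply: (@num_overpartitions_cons _ _ _ (N.+1, false)) => //.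
- move=> y s; rewrite is_overpartition_cons => /and4P[_ _ rel _].
  case: eqVneq => [yx|yx] /=.
    by rewrite yx /parts_in_plain /parts_in /= ltnn leqnn DN in_cons xpair_eqE andbF.
  rewrite orbF /parts_in_plain in_cons negb_or /= -/(parts_in _ _).
  case: y yx rel => a b; rewrite xpair_eqE /= => yx rel.
  case: (leqP a N) => [le_a|lt_a] /=; last first.
    case: (eqVneq a N.+1) yx => [->|ne _]; first by case: b {rel}; rewrite ?eqxx ?andbF.
    by have -> : (a <= N.+1)%N = false by lia.
  have -> /= : (a <= N.+1)%N by lia.
  case: (D a) => //=.
  have -> : (N.+1, true) != (a, b) by rewrite xpair_eqE; lia.
  have le_s z : z \in s -> (z.1 <= N)%N.
    by move=> /(allP rel) /andP[/= za _]; exact: leq_trans za le_a.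
  have -> : (N.+1, true) \notin s by apply/negP => /le_s; rewrite ltnn.
  rewrite !andbT; apply: eq_in_all => z /le_s le_z.
  by rewrite le_z (leq_trans le_z).
- by move=> s _ _; rewrite /parts_in /= ltnn.
- by move=> s; rewrite (parts_in_plain_rel _ false) => /andP[].
Qed.

Lemma num_parts_in_skip N n : ~~ D N.+1 ->
  num_overpartitions (parts_in N.+1) n = num_overpartitions (parts_in N) n.
Proof.
move=> DN; apply: eq_num_overpartitions => s _; apply: eq_all => y /=.
case: (eqVneq y.1 N.+1) => [->|ne]; first by rewrite (negbTE DN) !andbF.
by congr (_ && _); lia.
Qed.

Lemma num_parts_in0 n : num_overpartitions (parts_in 0) n = (n == 0%N).
Proof.
have -> : (n == 0%N) = size (nseq (n == 0%N) (@nil (nat * bool))) :> nat.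
  by rewrite size_nseq.
apply: num_overpartitionsE; first by case: eqP.
case=> [|y s]; first by rewrite mem_nseq is_overpartitionE /= !andbT; case: n.
rewrite mem_nseq is_overpartition_cons /= andbF.
by case: y => -[|a] b; rewrite ?andbF.
Qed.

Lemma num_parts_in_full N n : (n <= N)%N ->
  num_overpartitions (parts_in N) n =
  num_overpartitions (fun s => all D (parts s)) n.
Proof.
move=> le_n; apply: eq_num_overpartitions => s; rewrite is_overpartitionE.
case/and3P => _ _ /eqP sum_s; rewrite /parts all_map; apply: eq_in_all => y ys /=.
suff -> : (y.1 <= N)%N by [].
apply: leq_trans le_n; rewrite -sum_s /parts.
elim: s ys {sum_s} => //= z s IH; rewrite in_cons => /predU1P[->|/IH].
  exact: leq_addr.
by move/leq_trans; apply; exact: leq_addl.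
Qed.

End PartsIn.

(** * Congruence of polynomials modulo a power of ['X] *)

Section CoefCongruence.
Local Open Scope ring_scope.
Variable R : idomainType.
Implicit Types p q r : {poly R}.

Definition eqmodX L p q : Prop := forall i, (i < L)%N -> p`_i = q`_i.

Lemma eqmodX_sym L p q : eqmodX L p q -> eqmodX L q p.
Proof. by move=> pq i /pq. Qed.

Lemma eqmodX_trans L q p r : eqmodX L p q -> eqmodX L q r -> eqmodX L p r.
Proof. by move=> pq qr i lt_i; rewrite pq ?qr. Qed.

Lemma eqmodX_le M L p q : (L <= M)%N -> eqmodX M p q -> eqmodX L p q.
Proof. by move=> LM pq i lt_i; apply: pq; exact: leq_trans LM. Qed.

Lemma eqmodXM L p p' q q' :
  eqmodX L p p' -> eqmodX L q q' -> eqmodX L (p * q) (p' * q').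
Proof.
move=> pp' qq' i lt_i; rewrite !coefM; apply: eq_bigr => j _.
by rewrite pp' ?qq' //; have := ltn_ord j; lia.
Qed.

Lemma eqmodXMl L r p q : eqmodX L p q -> eqmodX L (r * p) (r * q).
Proof. exact: eqmodXM. Qed.

Lemma eqmodXMr L r p q : eqmodX L p q -> eqmodX L (p * r) (q * r).
Proof. by move=> pq; apply: eqmodXM. Qed.

Lemma eqmodX_sum L (I : Type) (s : seq I) (F G : I -> {poly R}) :
  (forall i, eqmodX L (F i) (G i)) ->
  eqmodX L (\sum_(i <- s) F i) (\sum_(i <- s) G i).
Proof. by move=> FG j lt_j; rewrite !coef_sum; apply: eq_bigr => i _; exact: FG. Qed.

Lemma eqmodX_shift L e p q :
  eqmodX L p q -> eqmodX (e + L) ('X^e * p) ('X^e * q).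
Proof.
by move=> pq i lt_i; rewrite !coefXnM; case: ifP => // ei; apply: pq; lia.
Qed.

Lemma eqmodX_cancel L r p q :
  r`_0 = 1 -> eqmodX L (r * p) (r * q) -> eqmodX L p q.
Proof.
move=> r0 pq i; elim/ltn_ind: i => i IH lt_i.
move: (pq i lt_i); rewrite !coefM !big_ord_recl /= r0 !mul1r subn0.
rewrite (eq_bigr (fun j : 'I_i => r`_(bump 0 j) * q`_(i - bump 0 j))).
  exact: addIr.
move=> j _; rewrite IH //; have := ltn_ord j; rewrite /bump /=; lia.
Qed.

Lemma eqmodX_comp L m p q : (0 < m)%N ->
  eqmodX L p q -> eqmodX (m * L) (p \Po 'X^m) (q \Po 'X^m).
Proof.
move=> m0 pq i lt_i; rewrite !coef_comp_poly_Xn //; case: ifP => // _.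
by apply: pq; rewrite ltn_divLR // mulnC.
Qed.

Lemma coef0_prod (I : Type) (s : seq I) (P : pred I) (F : I -> {poly R}) :
  (forall i, P i -> (F i)`_0 = 1) -> (\prod_(i <- s | P i) F i)`_0 = 1.
Proof.
move=> F0; apply: (big_ind (fun p : {poly R} => p`_0 = 1)) => //.
  by rewrite coef1.
by move=> p q p0 q0; rewrite coefM big_ord1 p0 q0 mulr1.
Qed.

End CoefCongruence.

Arguments eqmodX {R} L p q.

(** * Gaussian binomials and the finite triple product *)

Section TripleProduct.
Local Open Scope ring_scope.
Local Notation P := {poly int}.

Definition qpoch (x : P) (n : nat) : P := \prod_(i < n) (1 - x ^+ i.+1).

Lemma qpochS x n : qpoch x n.+1 = qpoch x n * (1 - x ^+ n.+1).
Proof. by rewrite /qpoch big_ord_recr. Qed.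

(** The q-Pascal recursion avoids division, so the values are visibly polynomials. *)
Fixpoint gauss_binom (x : P) (n k : nat) : P :=
  match n, k with
  | _, 0 => 1
  | 0, _.+1 => 0
  | n'.+1, k'.+1 => gauss_binom x n' k' + x ^+ k'.+1 * gauss_binom x n' k'.+1
  end.

Lemma gauss_binom0 x n : gauss_binom x n 0 = 1. Proof. by case: n. Qed.

Lemma gauss_binom_small x n k : (n < k)%N -> gauss_binom x n k = 0.
Proof.
elim: n k => [|n IH] [|k] //=; rewrite ltnS => lt_nk.
by rewrite !IH ?mulr0 ?addr0 // ltnW.
Qed.

Lemma gauss_binom_qpoch x n k : (k <= n)%N ->
  gauss_binom x n k * (qpoch x k * qpoch x (n - k)) = qpoch x n.
Proof.
elim: n k => [|n IH] [|k] //.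
- by rewrite /qpoch !big_ord0 !mulr1.
- by rewrite subn0 gauss_binom0 /qpoch big_ord0 !mul1r.
rewrite ltnS => le_kn /=; rewrite subSS mulrDl.
move: (IH k le_kn) => IHk.
have [lt_kn|ge_kn] := ltnP k n; last first.
  move: IHk; have -> : k = n by lia.
  rewrite (@gauss_binom_small x n n.+1) // mulr0 mul0r addr0 !qpochS => IHn.
  by rewrite -[in RHS]IHn; ring.
move: (IH k.+1 lt_kn); have -> : (n - k = (n - k.+1).+1)%N by lia.
move: IHk; have -> : (n - k = (n - k.+1).+1)%N by lia.
rewrite !qpochS; set g := gauss_binom _ _ _; set h := gauss_binom _ _ _.
move=> E1 E2; have -> : x ^+ n.+1 = x ^+ k.+1 * x ^+ (n - k.+1).+1.
  by rewrite -exprD; congr (_ ^+ _); lia.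
rewrite [X in _ = X]mulrBr mulr1.
set Q := qpoch x n in E1 E2 *.
(* This uses 1 - x^(n+1) = (1 - x^(k+1)) + x^(k+1) (1 - x^(n-k)). *)
transitivity (Q * (1 - x ^+ k.+1) + x ^+ k.+1 * (Q * (1 - x ^+ (n - k.+1).+1))).
  by rewrite -{1}E1 -E2; ring.
by ring.
Qed.

(** Splitting off the factor [y + x] leaves the same product with [x * q] for [x]; the q-Pascal
    recursion then merges the two sums. The homogeneous form avoids negative powers when it is
    specialized. *)
Lemma qbinomial_theorem (q x y : P) n :
  \prod_(i < n) (y + x * q ^+ i) =
  \sum_(k < n.+1) q ^+ 'C(k, 2) * gauss_binom q n k * x ^+ k * y ^+ (n - k).
Proof.
elim: n x => [|n IH] x; first by rewrite big_ord0 big_ord1 /= !mulr1.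
rewrite big_ord_recl expr0 mulr1.
under eq_bigr => i _ do rewrite lift0 exprS mulrA.
rewrite IH mulrDl.
transitivity (y ^+ n.+1 +
  \sum_(i < n.+1) q ^+ 'C(i.+1, 2) * (q ^+ i.+1 * gauss_binom q n i.+1) *
    x ^+ i.+1 * y ^+ (n - i) +
  \sum_(i < n.+1) q ^+ 'C(i.+1, 2) * gauss_binom q n i * x ^+ i.+1 * y ^+ (n - i)).
  congr (_ + _).
    rewrite big_ord_recl [in RHS]big_ord_recr /=.
    rewrite (@gauss_binom_small q n n.+1) // !(mulr0, mul0r) addr0 mulrDr.
    congr (_ + _); first by rewrite gauss_binom0 subn0 exprS; ring.
    rewrite big_distrr; apply: eq_bigr => i _ /=.
    rewrite /bump leq0n add1n.
    have -> : (n - i = (n - i.+1).+1)%N by have := ltn_ord i; lia.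
    by rewrite exprMn [y ^+ _.+1]exprS; ring.
  rewrite big_distrr; apply: eq_bigr => i _ /=.
  by rewrite binS bin1 exprD exprMn [x ^+ _.+1]exprS; ring.
rewrite [RHS]big_ord_recl gauss_binom0 subn0 !expr0 !mul1r -addrA; congr (_ + _).
rewrite -big_split; apply: eq_bigr => i _; rewrite lift0 subSS /=.
by ring.
Qed.

Lemma eqmodX_1BXn L e : (L <= e)%N -> eqmodX L (1 - 'X^e : P) 1.
Proof.
by move=> le_e i lt_i; rewrite coefB coefXn ltn_eqF ?subr0 //; exact: leq_trans le_e.
Qed.

Lemma qpoch_trunc m n : (m <= n)%N ->
  eqmodX (2 * m.+1) (qpoch 'X^2 n) (qpoch 'X^2 m).
Proof.
elim: n => [|n IH]; first by rewrite leqn0 => /eqP ->.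
rewrite leq_eqVlt => /predU1P[-> //|]; rewrite ltnS => le_mn.
apply: eqmodX_trans (IH le_mn); rewrite qpochS -{2}[qpoch _ n]mulr1.
by apply: eqmodXMl; rewrite -exprM; apply: eqmodX_1BXn; lia.
Qed.

Lemma qpoch_coef0 n : (qpoch 'X^2 n)`_0 = 1.
Proof.
by apply: coef0_prod => i _; rewrite -exprM coefB coef1 coefXn subr0.
Qed.

(** In the quotient (q^2; q^2)_(2n) / ((q^2; q^2)_k (q^2; q^2)_(2n-k)) every index is at least [m],
    so each Pochhammer symbol is congruent to the one of index [m]. *)
Lemma gauss_binom_limit m n k : (m <= n)%N -> (m <= k)%N -> (k + m <= n + n)%N ->
  eqmodX (2 * m.+1) (gauss_binom 'X^2 (n + n) k * qpoch 'X^2 n) 1.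
Proof.
move=> le_mn le_mk le_k; apply: (@eqmodX_cancel _ _ (qpoch 'X^2 m)).
  exact: qpoch_coef0.
rewrite mulr1; apply: (@eqmodX_trans _ _ (qpoch 'X^2 (n + n))); last first.
  by apply: qpoch_trunc; lia.
have le_kn : (k <= n + n)%N by lia.
have <- := gauss_binom_qpoch 'X^2 _ _ le_kn.
rewrite [X in eqmodX _ X _]mulrCA; apply: eqmodXMl; apply: eqmodXM; apply: eqmodX_sym.
  exact: qpoch_trunc.
apply: (@eqmodX_trans _ _ (qpoch 'X^2 m)); first by apply: qpoch_trunc; lia.
by apply: eqmodX_sym; apply: qpoch_trunc.
Qed.

Definition odd_prod n : P := \prod_(i < n) (1 + 'X^(2 * i + 1)).

Lemma prod_X_even n : \prod_(i < n) 'X^(2 * i) = 'X^(n * n.-1) :> P.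
Proof.
elim: n => [|n IH]; first by rewrite big_ord0.
by rewrite big_ord_recr /= IH -exprD; congr ('X^_); case: n {IH} => //= n; lia.
Qed.

(** For [i < n] the factor ['X^(2 * i)] comes out and leaves the odd exponents in decreasing order;
    from the last [n] factors ['X^(2 * n - 1)] comes out and leaves them in increasing order. *)
Lemma odd_prod_sq_shift n :
  \prod_(i < n + n) ('X^(2 * n - 1) + 1 * 'X^2 ^+ i) =
  'X^(n * n.-1 + (2 * n - 1) * n) * odd_prod n ^+ 2 :> P.
Proof.
rewrite big_split_ord /= [odd_prod n ^+ 2]expr2 exprD mulrACA; congr (_ * _).
  rewrite -prod_X_even /odd_prod [X in _ = _ * X](reindex_inj rev_ord_inj) /=.
  rewrite -big_split; apply: eq_bigr => i _ /=.
  rewrite mul1r mulrDr mulr1 -exprM -exprD addrC; congr (_ + 'X^_).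
  by have := ltn_ord i; lia.
have -> : 'X^((2 * n - 1) * n) = \prod_(i < n) 'X^(2 * n - 1) :> P.
  by rewrite prodr_const card_ord exprM.
rewrite -big_split; apply: eq_bigr => i _ /=.
rewrite mul1r mulrDr mulr1 -exprM -exprD; congr (_ + 'X^_).
by have := ltn_ord i; lia.
Qed.

Lemma bin2_double k : (2 * 'C(k, 2) + k = k * k)%N.
Proof. by elim: k => // k IH; rewrite binS bin1; nia. Qed.

(* With truncated subtraction, n - k + (k - n) is the distance |n - k|. *)
Lemma odd_prod_sqE n :
  odd_prod n ^+ 2 =
  \sum_(k < (n + n).+1)
    'X^((n - k + (k - n)) ^ 2) * gauss_binom 'X^2 (n + n) k.
Proof.
have nz : 'X^(n * n.-1 + (2 * n - 1) * n) != 0 :> P by rewrite monic_neq0 ?monicXn.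
apply: (mulfI nz); rewrite -odd_prod_sq_shift qbinomial_theorem big_distrr.
apply: eq_bigr => k _ /=; rewrite expr1n mulr1 mulrAC mulrA -!exprM -!exprD.
(* What remains is k(k-1) + (2n-1)(2n-k) = n(n-1) + (2n-1)n + (n-k)^2; the sign of n - k is split to
   remove truncated subtractions. *)
congr ('X^_ * _); have := bin2_double k; have := ltn_ord k; move: (nat_of_ord k).
case: n {nz k} => [|n] k; first by lia.
rewrite ltnS => le_k; move: 'C(k, 2) => C EC.
case: (leqP k n.+1) => le_kn.
  have [d En] : exists d, n.+1 = (k + d)%N by exists (n.+1 - k)%N; lia.
  have -> : (n.+1 - k + (k - n.+1) = d)%N by lia.
  have -> : (n.+1 + n.+1 - k = n.+1 + d)%N by lia.
  have -> : (2 * n.+1 - 1 = 2 * n + 1)%N by lia.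
  rewrite /=; nia.
have [d En] : exists d, k = (n.+1 + d)%N by exists (k - n.+1)%N; lia.
have -> : (n.+1 - k + (k - n.+1) = d)%N by lia.
have [e En'] : exists e, n.+1 = (d + e)%N by exists (n.+1 - d)%N; lia.
have -> : (n.+1 + n.+1 - k = e)%N by lia.
have -> : (2 * n.+1 - 1 = 2 * n + 1)%N by lia.
rewrite /=; nia.
Qed.

(** This is phi(q) cut to |j| <= n, with k = n + j. *)
Definition theta n : P := \sum_(k < (n + n).+1) 'X^((n - k + (k - n)) ^ 2).

Lemma theta_product n :
  eqmodX (2 * n).+1 (odd_prod n ^+ 2 * qpoch 'X^2 n) (theta n).
Proof.
rewrite odd_prod_sqE big_distrl; apply: eqmodX_sum => k /=.
rewrite -mulrA -[X in eqmodX _ _ X]mulr1.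
set d := (n - k + (k - n))%N; have le_k := ltn_ord k.
(* The shift by d^2 makes up for the precision lost far from the centre: d^2 + 2(n - d + 1) = 2n + 1
   + (d - 1)^2. *)
apply: (@eqmodX_le _ (d ^ 2 + 2 * (n - d).+1)); first by nia.
by apply: eqmodX_shift; apply: gauss_binom_limit; rewrite /d; lia.
Qed.

End TripleProduct.

(** * Generating functions of the two counts *)

Section GeneratingFunctions.
Local Open Scope ring_scope.
Local Notation P := {poly int}.

Definition gf (f : nat -> nat) L : P := \poly_(i < L) (f i)%:Z.

Lemma gf_shiftD L e (f g h : nat -> nat) :
  (forall i, f i = g i + if e <= i then h (i - e) else 0)%N ->
  eqmodX L (gf f L) (gf g L + 'X^e * gf h L).
Proof.
move=> fgh i lt_i; rewrite coefD coefXnM !coef_poly lt_i fgh PoszD.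
case: ltnP => // le_ei; rewrite (leq_ltn_trans _ lt_i) //; exact: leq_subr.
Qed.

(** With the denominator cleared, an allowed new part size gives (1 - q^N) A_N = (1 + q^N) (1 - q^N)
    B_N = (1 + q^N) A_(N-1). *)
Lemma gf_parts_in (D : pred nat) N L :
  eqmodX L
    ((\prod_(k < N | D k.+1) (1 - 'X^(k.+1))) * gf (num_overpartitions (parts_in D N)) L)
    (\prod_(k < N | D k.+1) (1 + 'X^(k.+1))).
Proof.
elim: N => [|N IH].
  move=> i lt_i; rewrite !big_ord0 mul1r coef_poly lt_i coef1.
  by rewrite num_parts_in0; case: eqP.
rewrite big_mkcond [X in eqmodX _ _ X]big_mkcond !big_ord_recr -!big_mkcond /=.
case: ifPn => DN; last first.
  rewrite !mulr1; apply: eqmodX_trans IH; apply: eqmodXMl => i lt_i.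
  by rewrite !coef_poly lt_i num_parts_in_skip.
set b := \prod_(k < N | _) (1 - _) in IH *; set a := \prod_(k < N | _) _ in IH *.
set A := gf _ L; set A0 := gf _ L in IH.
pose B := gf (num_overpartitions (parts_in_plain D N.+1)) L.
have eqA : eqmodX L A (B + 'X^(N.+1) * B).
  by apply: gf_shiftD => i; exact: num_parts_in_overlined.
have eqB : eqmodX L B (A0 + 'X^(N.+1) * B).
  by apply: gf_shiftD => i; exact: num_parts_in_plain.
have {}eqB : eqmodX L ((1 - 'X^(N.+1)) * B) A0.
  move=> i lt_i; rewrite mulrBl mul1r coefB eqB // coefD.
  by rewrite addrK.
apply: (@eqmodX_trans _ _ (b * (1 - 'X^(N.+1)) * (B + 'X^(N.+1) * B))).
  exact: eqmodXMl.
have -> : b * (1 - 'X^(N.+1)) * (B + 'X^(N.+1) * B) =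
  b * ((1 - 'X^(N.+1)) * B) * (1 + 'X^(N.+1)) by ring.
by apply: eqmodXMr; apply: eqmodX_trans IH; exact: eqmodXMl.
Qed.

Lemma prod_odd_index (F : nat -> P) n :
  \prod_(k < 2 * n | odd k.+1) F k.+1 = \prod_(k < n) F (2 * k + 1)%N.
Proof.
elim: n => [|n IH]; first by rewrite !big_ord0.
rewrite [RHS]big_ord_recr -IH (_ : 2 * n.+1 = (2 * n).+2)%N; last by lia.
rewrite big_mkcond 2!big_ord_recr -big_mkcond /=.
by rewrite mul2n odd_double /= mulr1 addn1.
Qed.

(** Up to degree [2 * n] only parts at most [2 * n] occur, so bounding the parts loses nothing in
    this range. *)
Lemma gf_pbar_odd n :
  eqmodX (2 * n).+1
    ((\prod_(k < n) (1 - 'X^(2 * k + 1))) * gf pbar_odd (2 * n).+1) (odd_prod n).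
Proof.
move: (gf_parts_in odd (2 * n) (2 * n).+1).
rewrite (prod_odd_index (fun k => 1 - 'X^k)) (prod_odd_index (fun k => 1 + 'X^k)).
apply: eqmodX_trans; apply: eqmodXMl => i lt_i.
by rewrite !coef_poly lt_i num_parts_in_full.
Qed.

Lemma gf_pbar2 n :
  eqmodX (2 * n).+1 (qpoch 'X^2 n * (gf (pbar \o Posz) n.+1 \Po 'X^2))
    (\prod_(k < n) (1 + 'X^2 ^+ k.+1)).
Proof.
have H : eqmodX n.+1 ((\prod_(k < n) (1 - 'X^(k.+1))) * gf (pbar \o Posz) n.+1)
   (\prod_(k < n) (1 + 'X^(k.+1))).
  apply: eqmodX_trans (gf_parts_in predT n n.+1); apply: eqmodXMl => i lt_i.
  rewrite !coef_poly lt_i num_parts_in_full //=; congr Posz.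
  by apply: eq_num_overpartitions => s _; rewrite all_predT.
move/(@eqmodX_comp _ _ 2 _ _ isT): H.
rewrite rmorphM !rmorph_prod /= => H.
rewrite /qpoch; apply: (@eqmodX_le _ (2 * n.+1)); first by lia.
move: H; congr (eqmodX _ (_ * _) _); apply: eq_bigr => k _.
  by rewrite rmorphB rmorph1 rmorphXn /= comp_polyX.
by rewrite rmorphD rmorph1 rmorphXn /= comp_polyX.
Qed.

(* Euler's identity 1 / (q^2; q^4) = (-q^2; q^2), read off from
   (q^2; q^2) = (q^2; q^4) (q^4; q^4). *)
Lemma euler_odd_distinct n :
  eqmodX (2 * n).+1
    (odd_prod n * (\prod_(k < n) (1 - 'X^(2 * k + 1))) *
     (\prod_(k < n) (1 + 'X^2 ^+ k.+1))) 1.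
Proof.
apply: (@eqmodX_cancel _ _ (qpoch 'X^2 n)); first exact: qpoch_coef0.
rewrite mulr1; apply: (@eqmodX_trans _ _ (qpoch 'X^2 (2 * n))); last first.
  by apply: (@eqmodX_le _ (2 * n.+1)); [lia | apply: qpoch_trunc; lia].
suff -> : qpoch 'X^2 (2 * n) = qpoch 'X^2 n *
  (odd_prod n * (\prod_(k < n) (1 - 'X^(2 * k + 1))) *
     (\prod_(k < n) (1 + 'X^2 ^+ k.+1))) by [].
rewrite /qpoch /odd_prod -!big_split /=.
elim: n => [|n IH]; first by rewrite !big_ord0.
rewrite [RHS]big_ord_recr -IH (_ : 2 * n.+1 = (2 * n).+2)%N; last by lia.
(* The two new factors are differences of squares: 1 - q^(4n+2) splits into 1 - q^(2n+1) and 1 +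
   q^(2n+1), and 1 - q^(4n+4) into 1 - q^(2n+2) and 1 + q^(2n+2). *)
rewrite 2!big_ord_recr /= -mulrA; congr (_ * _).
have -> : 'X^2 ^+ (2 * n).+1 = 'X^(2 * n + 1) * 'X^(2 * n + 1) :> P.
  by rewrite -exprM -exprD; congr ('X^_); lia.
have -> : 'X^2 ^+ (2 * n).+2 = 'X^2 ^+ n.+1 * 'X^2 ^+ n.+1 :> P.
  by rewrite -exprD; congr (_ ^+ _); lia.
by ring.
Qed.

Lemma gf_pbar_odd_theta n :
  eqmodX (2 * n).+1 (gf pbar_odd (2 * n).+1)
    (theta n * (gf (pbar \o Posz) n.+1 \Po 'X^2)).
Proof.
have HO := gf_pbar_odd n; have HP := gf_pbar2 n.
have HE := euler_odd_distinct n; have HT := theta_product n.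
have c0 := qpoch_coef0 n.
have b0 : (\prod_(k < n) (1 - 'X^(2 * k + 1)) : P)`_0 = 1.
  by apply: coef0_prod => k _; rewrite coefB coef1 coefXn addn1 subr0.
move: HO HP HE HT c0 b0.
set O := gf _ _; set Q := _ \Po _; set b := \prod_(k < n) (1 - _).
set d := \prod_(k < n) _; set c := qpoch _ _; set a := odd_prod n; set t := theta n.
move=> HO HP HE HT c0 b0.
(* Once multiplied by [b] and [c], both sides are congruent to [c * a]: the left by [HO], the right
   by [HP], [HT] and [HE] in turn. *)
apply: (eqmodX_cancel _ _ b) => //; apply: (eqmodX_cancel _ _ c) => //.
apply: (@eqmodX_trans _ _ (c * a)); first exact: eqmodXMl.
apply: eqmodX_sym; have -> : c * (b * (t * Q)) = b * t * (c * Q) by ring.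
apply: (eqmodX_trans _ _ (b * t * d)); first exact: eqmodXMl.
apply: (eqmodX_trans _ _ (b * (a ^+ 2 * c) * d)).
  by apply: eqmodXMr; apply: eqmodXMl; exact: eqmodX_sym.
have -> : b * (a ^+ 2 * c) * d = c * a * (a * b * d) by ring.
by rewrite -[X in eqmodX _ _ X]mulr1; apply: eqmodXMl.
Qed.

End GeneratingFunctions.

(** * Comparison of the coefficients of q^(2n) *)

Lemma sum_nat_fold (f : nat -> nat) n :
  (\sum_(k < (n + n).+1) f (n - k + (k - n)) = f 0 + 2 * \sum_(1 <= j < n.+1) f j)%N.
Proof.
rewrite -addSn big_split_ord /= (reindex_inj rev_ord_inj) /=.
rewrite (eq_bigr (fun j : 'I_n.+1 => f j)); last first.
  by move=> j _; congr f; have := ltn_ord j; lia.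
rewrite big_ord_recl /= -addnA mul2n -addnn; congr (_ + (_ + _))%N.
  by rewrite big_add1 big_mkord.
rewrite big_add1 big_mkord; apply: eq_bigr => j _; congr f.
by move: (nat_of_ord j) => i; lia.
Qed.

(** Vanishing beyond [n] lets the left sum run up to [2 * n], where its even indices are the [2 * k]
    with k <= n. *)
Lemma sum_nat_even (f : nat -> nat) n :
  (forall j, odd j -> f j = 0)%N -> (forall j, n < j -> f j = 0)%N ->
  (\sum_(1 <= j < n.+1) f j = \sum_(1 <= k < n.+1) f (2 * k))%N.
Proof.
move=> f_odd f_big.
have -> : (\sum_(1 <= j < n.+1) f j = \sum_(1 <= j < (2 * n).+1) f j)%N.
  rewrite (@big_cat_nat _ _ _ n.+1 1 (2 * n).+1) //=; last by lia.
  rewrite [X in (_ + X)%N]big_nat_cond [X in (_ + X)%N]big1 ?addn0 // => j.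
  by rewrite andbT => /andP[/f_big].
elim: n {f_big} => [|n IH]; first by rewrite !big_geq.
rewrite [RHS]big_nat_recr //= -IH (_ : 2 * n.+1 = (2 * n).+2)%N; last by lia.
rewrite big_nat_recr //= big_nat_recr //= (f_odd (2 * n).+1) ?addn0 //.
by rewrite mul2n /= odd_double.
Qed.

Lemma pbar_sub (n m : nat) :
  pbar (n%:Z - m%:Z)%R = if (m <= n)%N then pbar (n - m)%N%:Z else 0%N.
Proof.
case: leqP => [le_mn|lt_nm]; first by rewrite subzn.
have: (n%:Z - m%:Z < 0)%R by lia.
by case: (n%:Z - m%:Z)%R.
Qed.

Theorem theorem3p7 (n : nat) :
  pbar_odd (2 * n)
  = pbar n%:Z
    + 2 * \big[addn/0]_(k \in [set k : nat | 1 <= k]%classic)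
            pbar (n%:Z - 2 * k%:Z ^+ 2)%R.
Proof.
(* [f j] is the coefficient of q^(2n) in q^(j^2) times the series of [pbar] at q^2. *)
pose f j := if (j ^ 2 <= 2 * n)%N && ~~ odd j
            then pbar (n - j ^ 2 %/ 2)%N%:Z else 0%N.
have f_double k : pbar (n%:Z - 2 * k%:Z ^+ 2)%R = f (2 * k)%N.
  have -> : (2 * k%:Z ^+ 2 = (2 * k ^ 2)%N%:Z)%R by lia.
  rewrite pbar_sub /f oddM andbT expnMn.
  by rewrite -[(2 ^ 2)%N]/(2 * 2)%N -mulnA leq_pmul2l // mulKn.
have f_large j : (n < j)%N -> f j = 0%N.
  by move=> lt_j; rewrite /f ifF //; nia.
have /(_ (ltnSn _)) := gf_pbar_odd_theta n (2 * n)%N.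
rewrite coef_poly ltnSn big_distrl coef_sum /=.
rewrite (eq_bigr (fun k : 'I_(n + n).+1 => Posz (f (n - k + (k - n))))); last first.
  move=> k _; rewrite coefXnM /f; move: (_ + (k - n))%N => j.
  rewrite ltnNge; case: (leqP (j ^ 2) (2 * n)) => //= le_j.
  rewrite coef_comp_poly_Xn // coef_poly.
  have -> : (2 %| 2 * n - j ^ 2)%N = ~~ odd j.
    by rewrite dvdn2 oddB // oddX mul2n odd_double /=; case: odd.
  case: ifP => // ev; rewrite ifT; last by lia.
  have -> : (j ^ 2 = 2 * (j * j./2))%N.
    by rewrite mulnCA mul2n even_halfK // mulnn.
  by rewrite -mulnBr !mulKn.
rewrite -(big_morph Posz PoszD (erefl 0%Z)) => -[->].
rewrite sum_nat_fold sum_nat_even //; last by move=> j oj; rewrite /f oj andbF.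
rewrite {1}/f /= subn0; congr (_ + 2 * _)%N.
(* The sum over all k >= 1 reduces to k <= n, as beyond that 2k > n and [f_large] applies. *)
rewrite (@fsbigE _ _ _ _ _ (index_iota 1 n.+1)).
- apply: congr_big_nat => // k /andP[k1 _].
  by rewrite mem_set.
- exact: iota_uniq.
- by move=> k /=; rewrite mem_index_iota => /andP[].
- move=> k /= k1; rewrite mem_index_iota k1 /= -leqNgt => lt_k.
  by rewrite f_double f_large //; lia.
Qed.
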